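(* Fix $n\ge 1$ and a conservative pseudo-adder on $n$-bit inputs satisfying the standing assumption. Let $G$ be the weighted directed acyclic graph of carry chains defined in the context, let $w_{\min}$ be the minimum weight of the paths in $G$ and $w_{\max}$ the maximum weight of the paths in $G$. Then the maximum absolute value of an error, $\max_{a,b}|s(a,b)-s'(a,b)|$ over all $a,b\in\{0,\dots,2^n-1\}$, equals $\max\{-w_{\min},w_{\max}\}$.
   Context: Inputs: integers $a,b\in\{0,\dots,2^n-1\}$ with binary digits $a_k,b_k$ for $0\le k\le n$, so $a_n=b_n=0$. True carries and sum bits: $c_0=0$, $c_k=a_{k-1}b_{k-1}\lor a_{k-1}c_{k-1}\lor b_{k-1}c_{k-1}$ for $1\le k\le n$, and $s_k=a_k\oplus b_k\oplus c_k$ for $0\le k\le n$; so $s(a,b)=\sum_{k=0}^n s_k2^k=a+b$. Carry chains: for $1\le i\le j\le n$, the pair $(a,b)$ generates the $i$-$j$ carry chain if $a_{i-1}=b_{i-1}=1$, $a_k\ne b_k$ for $i\le k\le j-1$, and $a_j=b_j$. A carry chain is identified with the pair $(i,j)$. Pseudo-adder: functions $c'_k=c'_k(a,b)\in\{0,1\}$ for $0\le k\le n$, where $c'_0=0$ and, for $k\ge1$, $c'_k$ depends only on $a_{k-1},\dots,a_0$ and $b_{k-1},\dots,b_0$. Its computed sum is $s'(a,b)=\sum_{k=0}^n s'_k2^k$ with $s'_k=a_k\oplus b_k\oplus c'_k$. It is conservative if $c'_k(a,b)\le c_k(a,b)$ for all $k$ and all $(a,b)$. Standing assumption: whenever $(a,b)$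 generates the $i$-$j$ carry chain and $i\le k\le j$, the value $c'_k(a,b)$ does not depend on the bits of $a,b$ in positions lower than $i-1$, nor on which pair $(a,b)$ generating the chain is considered. Error of a chain: for an $i$-$j$ carry chain $C$ and any $(a,b)$ generating it, let $(a^C,b^C)$ agree with $(a,b)$ in positions $i-1,\dots,j-1$ and have all other bits $0$. Then $\mathrm{EC}(C)=s(a^C,b^C)-s'(a^C,b^C)$, which by the standing assumption is independent of the choice of $(a,b)$. The graph $G=(V,E)$: $V=\{(i,j):1\le i\le j\le n\}$, vertex $(i,j)$ corresponding to the $i$-$j$ carry chain; $E$ is the set of directed edges from $(i_1,j_1)$ to $(i_2,j_2)$ with $j_1<i_2$; the weight of vertex $(i,j)$ is $\mathrm{EC}$ of the $i$-$j$ carry chain (it may be negative, positive or zero). A path is a directed path with at least one vertex (single vertices allowed), and its weight is the sum of the weights of its vertices. *)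

(* Defs.v *)
From HB Require Import structures.
From mathcomp Require Import all_boot all_order all_algebra.
From mathcomp Require Import zify.
Set Implicit Arguments.
Unset Strict Implicit.
Unset Printing Implicit Defensive.
Import Order.TTheory GRing.Theory Num.Theory.

Definition bit (a k : nat) : bool := odd (a %/ 2 ^ k).

Fixpoint carry (a b k : nat) : bool :=
  if k is m.+1 then
    [|| bit a m && bit b m, bit a m && carry a b m | bit b m && carry a b m]
  else false.

(* The number whose k-th binary digit is a_k (+) b_k (+) c_k, for 0 <= k <= n. *)
Definition sum_with (n : nat) (c : 'I_n.+1 -> bool) (a b : nat) : nat :=
  \sum_(k < n.+1) (bit a k (+) bit b k (+) c k) * 2 ^ k.

Definition true_sum (n a b : nat) : nat := sum_with (fun k : 'I_n.+1 => carry a b k) a b.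

Record pseudo_adder (n : nat) := PseudoAdder {
  pcarry :> 'I_n.+1 -> 'I_(2 ^ n) -> 'I_(2 ^ n) -> bool;
  pcarry0 : forall a b, pcarry ord0 a b = false;
  pcarry_local : forall (k : 'I_n.+1) (a b a' b' : 'I_(2 ^ n)),
    (forall m, m < k -> bit a m = bit a' m /\ bit b m = bit b' m) ->
    pcarry k a b = pcarry k a' b'
}.

Definition pseudo_sum n (c : pseudo_adder n) (a b : 'I_(2 ^ n)) : nat :=
  sum_with (fun k => c k a b) a b.

Definition conservative n (c : pseudo_adder n) : Prop :=
  forall (k : 'I_n.+1) (a b : 'I_(2 ^ n)), c k a b <= carry a b k.

Definition error n (c : pseudo_adder n) (a b : 'I_(2 ^ n)) : int :=
  ((true_sum n a b)%:Z - (pseudo_sum c a b)%:Z)%R.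

Definition max_abs_error n (c : pseudo_adder n) : nat :=
  \max_(a : 'I_(2 ^ n)) \max_(b : 'I_(2 ^ n)) `|error c a b|%N.

Definition chain (n : nat) : Type := {p : 'I_n.+1 * 'I_n.+1 | 0 < p.1 <= p.2}.
Definition chain_start n (C : chain n) : nat := (val C).1.
Definition chain_end n (C : chain n) : nat := (val C).2.

Definition generates n (C : chain n) (a b : nat) : bool :=
  let i := chain_start C in let j := chain_end C in
  [&& bit a i.-1, bit b i.-1,
      [forall k : 'I_n, (i <= k < j) ==> (bit a k != bit b k)]
    & bit a j == bit b j].

(* Any two pairs generating the same chain are compared, in particular two pairs
   that differ only in positions below i-1. *)
Definition chain_determined n (c : pseudo_adder n) : Prop :=
  forall (C : chain n) (a b a' b' : 'I_(2 ^ n)),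
    generates C a b -> generates C a' b' ->
    forall k : 'I_n.+1, chain_start C <= k <= chain_end C ->
    c k a b = c k a' b'.

Lemma sum_bits_lt (f : nat -> bool) m : \sum_(0 <= k < m) f k * 2 ^ k < 2 ^ m.
Proof.
elim: m => [|m IH]; first by rewrite big_geq.
by rewrite big_nat_recr //= expnS; case: (f m); lia.
Qed.

Lemma bit_sum_bits (f : nat -> bool) m l :
  bit (\sum_(0 <= k < m) f k * 2 ^ k) l = (l < m) && f l.
Proof.
elim: m l => [|m IH] l; first by rewrite big_geq // /bit div0n.
rewrite big_nat_recr //= /bit; have := sum_bits_lt f m.
have [lm|ml|->] := ltngtP l m => Hs.
- have -> : (l < m.+1) = true by lia.
  have -> : f m * 2 ^ m = f m * 2 ^ (m - l) * 2 ^ l.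
    by rewrite -mulnA -expnD subnK // ltnW.
  rewrite addnC divnMDl ?expn_gt0 // oddD oddM oddX /= subn_eq0 leqNgt lm andbF /=.
  by rewrite -/(bit _ l) IH lm.
- rewrite ltnS leqNgt ml /= divn_small //.
  have : 2 ^ m.+1 <= 2 ^ l by rewrite leq_exp2l.
  by rewrite expnS; case: (f m); lia.
- rewrite ltnSn addnC divnMDl ?expn_gt0 // divn_small // addn0.
  by case: (f m).
Qed.

(* a^C: the digits of a in positions i-1, ..., j-1, all other digits being 0. *)
Definition cut_val n (C : chain n) (a : nat) : nat :=
  \sum_((chain_start C).-1 <= k < chain_end C) bit a k * 2 ^ k.

Lemma chainP n (C : chain n) :
  [&& 0 < chain_start C, chain_start C <= chain_end C & chain_end C <= n].
Proof.
have := valP C; have := ltn_ord (val C).2.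
by rewrite /chain_start /chain_end ltnS => -> /andP[-> ->].
Qed.

Lemma cut_valE n (C : chain n) a : cut_val C a =
  \sum_(0 <= k < chain_end C) (((chain_start C).-1 <= k) && bit a k) * 2 ^ k.
Proof.
have := chainP C => CP.
rewrite /cut_val (@big_cat_nat _ _ _ (chain_start C).-1 0) //=; last by lia.
rewrite [X in _ = X + _]big_nat [X in _ = X + _]big1 ?add0n => [|k /andP[_ hk]].
  by apply: eq_big_nat => k /andP[-> _].
by rewrite leqNgt hk.
Qed.

Lemma cut_lt n (C : chain n) (a : nat) : cut_val C a < 2 ^ n.
Proof.
rewrite cut_valE (@leq_trans (2 ^ chain_end C)) ?sum_bits_lt //.
by have := chainP C; rewrite leq_exp2l //; lia.
Qed.

Definition cut n (C : chain n) (a : 'I_(2 ^ n)) : 'I_(2 ^ n) := Ordinal (cut_lt C a).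

(* EC of a chain, computed from one chosen generating pair. Lemmas generates_ex
   and chain_errorE below show that a generating pair exists and that, if c is
   conservative and chain-determined, every generating pair gives the same value. *)
Definition chain_error n (c : pseudo_adder n) (C : chain n) : int :=
  if [pick ab : 'I_(2 ^ n) * 'I_(2 ^ n) | generates C ab.1 ab.2] is Some ab then
    error c (cut C ab.1) (cut C ab.2)
  else 0%R.

Definition edge n (C D : chain n) : bool := chain_end C < chain_start D.

Definition is_path n (P : seq (chain n)) : bool :=
  (0 < size P) && sorted (@edge n) P.

Definition path_weight n (c : pseudo_adder n) (P : seq (chain n)) : int :=
  (\sum_(C <- P) chain_error c C)%R.

Definition is_min_path_weight n (c : pseudo_adder n) (w : int) : Prop :=
  (exists2 P : seq (chain n), is_path P & path_weight c P = w) /\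
  (forall P : seq (chain n), is_path P -> (w <= path_weight c P)%R).

Definition is_max_path_weight n (c : pseudo_adder n) (w : int) : Prop :=
  (exists2 P : seq (chain n), is_path P & path_weight c P = w) /\
  (forall P : seq (chain n), is_path P -> (path_weight c P <= w)%R).

Lemma bit_cut n (C : chain n) a k :
  bit (cut_val C a) k = ((chain_start C).-1 <= k < chain_end C) && bit a k.
Proof.
by rewrite cut_valE (bit_sum_bits (fun k => (_ <= k) && bit a k)) andbA [X in X && _]andbC.
Qed.

Lemma generates_ex n (C : chain n) :
  exists ab : 'I_(2 ^ n) * 'I_(2 ^ n), generates C ab.1 ab.2.
Proof.
have CP := chainP C.
have lt1 (f : nat -> bool) : \sum_(0 <= k < chain_end C) f k * 2 ^ k < 2 ^ n.
  by rewrite (leq_trans (sum_bits_lt _ _)) // leq_exp2l //; lia.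
exists (Ordinal (lt1 (fun=> true)), Ordinal (lt1 (fun k => k == (chain_start C).-1))).
rewrite /generates /= !bit_sum_bits.
rewrite (bit_sum_bits (fun=> true)) (bit_sum_bits (fun=> true)) !ltnn eqxx !andbT /=.
have -> /= : (chain_start C).-1 < chain_end C by lia.
apply/forallP => k; apply/implyP => kP.
by rewrite !bit_sum_bits (bit_sum_bits (fun=> true)); lia.
Qed.

Lemma generates_cut n (C : chain n) (a b : nat) :
  generates C a b -> generates C (cut_val C a) (cut_val C b).
Proof.
have CP := chainP C.
case/and4P => ha hb /forallP hk hj; rewrite /generates !bit_cut ha hb ltnn !andbF.
rewrite eqxx leqnn !andbT /=.
have -> /= : (chain_start C).-1 < chain_end C by lia.
apply/forallP => k; apply/implyP => kP; rewrite !bit_cut.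
have -> /= : (chain_start C).-1 <= k < chain_end C by lia.
by have := hk k; rewrite kP.
Qed.

Lemma eq_carry a b a' b' k :
  (forall m, bit a m (+) bit b m = bit a' m (+) bit b' m) ->
  (forall m, bit a m && bit b m = bit a' m && bit b' m) ->
  carry a b k = carry a' b' k.
Proof.
move=> hx ha; elim: k => //= k ->.
by move: (hx k) (ha k); do 4!case: (bit _ _); case: carry.
Qed.

Lemma carry_cut n (C : chain n) a b k :
  generates C a b -> ~~ (chain_start C <= k <= chain_end C) ->
  carry (cut_val C a) (cut_val C b) k = false.
Proof.
have CP := chainP C => gab.
case: k => // k kout; rewrite /= !bit_cut.
by have -> : (chain_start C).-1 <= k < chain_end C = false by lia.
Qed.

Lemma chain_errorE n (c : pseudo_adder n) (C : chain n) (a b : 'I_(2 ^ n)) :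
  conservative c -> chain_determined c -> generates C a b ->
  chain_error c C = error c (cut C a) (cut C b).
Proof.
move=> cons det gab; rewrite /chain_error; case: pickP => [[a' b'] /= gab'|]; last first.
  by move/(_ (a, b)); rewrite /= gab.
have CP := chainP C.
have bits k : (chain_start C).-1 <= k < chain_end C ->
    bit a k (+) bit b k = bit a' k (+) bit b' k /\
    bit a k && bit b k = bit a' k && bit b' k.
  move=> kP; have [->|kN] := eqVneq k (chain_start C).-1.
    by case/and4P: gab => -> -> _ _; case/and4P: gab' => -> -> _ _.
  have kn : k < n by lia.
  case/and4P: gab => _ _ /forallP/(_ (Ordinal kn)) /= + _.
  case/and4P: gab' => _ _ /forallP/(_ (Ordinal kn)) /= + _.
  have -> /= : chain_start C <= k < chain_end C by lia.
  by do 4!case: (bit _ _).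
have hx m : bit (cut_val C a') m (+) bit (cut_val C b') m =
            bit (cut_val C a) m (+) bit (cut_val C b) m.
  by rewrite !bit_cut; have := bits m; case: (_ <= _ < _) => //= /(_ isT) [].
have ha m : bit (cut_val C a') m && bit (cut_val C b') m =
            bit (cut_val C a) m && bit (cut_val C b) m.
  by rewrite !bit_cut; have := bits m; case: (_ <= _ < _) => //= /(_ isT) [].
rewrite /error; congr (Posz _ - Posz _)%R; apply: eq_bigr => k _; rewrite hx.
  by rewrite (eq_carry k hx ha).
congr ((_ (+) _) * _).
case: (boolP (chain_start C <= k <= chain_end C)) => kP.
  by apply: det kP; exact: generates_cut.
have no (x y : 'I_(2 ^ n)) : generates C x y -> c k (cut C x) (cut C y) = false.
  by move=> g; have := cons k (cut C x) (cut C y); rewrite /= carry_cut // leqn0 eqb0 => /negbTE.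
by rewrite !no.
Qed.

(* Main.v *)
Require Import Defs.
From mathcomp Require Import all_boot all_order all_algebra.
From mathcomp Require Import zify.
Set Implicit Arguments.
Unset Strict Implicit.
Unset Printing Implicit Defensive.
Import Order.TTheory GRing.Theory Num.Theory.

(** Whenever the true carry at position k is 1, k lies in exactly one carry
    chain generated by (a, b), and the contribution of position k to the error
    is the one it makes in the cut pair of that chain; elsewhere conservativity
    makes the contribution vanish.  Hence the error of (a, b) is the sum of the
    chain errors over the chains it generates, and these chains form a path.
    Conversely, every path is the list of chains generated by some pair, so path
    weights are exactly the errors of the pairs generating a chain, all other
    pairs having error 0. *)

(** * Error contributions of single positions *)

Definition covers {n} (C : chain n) (k : nat) : bool :=
  chain_start C <= k <= chain_end C.

Definition error_at n (c : pseudo_adder n) (a b : 'I_(2 ^ n)) (k : 'I_n.+1) : int :=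
  (((bit a k (+) bit b k (+) carry a b k) * 2 ^ k)%:Z
   - ((bit a k (+) bit b k (+) c k a b) * 2 ^ k)%:Z)%R.

Lemma error_sum n (c : pseudo_adder n) a b :
  error c a b = (\sum_(k < n.+1) error_at c a b k)%R.
Proof.
by rewrite /error /true_sum /pseudo_sum /sum_with !(big_morph Posz PoszD (erefl _)) -sumrB.
Qed.

Lemma error_at_nocarry n (c : pseudo_adder n) (a b : 'I_(2 ^ n)) (k : 'I_n.+1) :
  conservative c -> ~~ carry a b k -> error_at c a b k = 0%R.
Proof.
move=> cons /negbTE nk; have := cons k a b; rewrite /error_at nk leqn0 eqb0.
by move=> /negbTE ->; rewrite subrr.
Qed.

Lemma generatesP n (C : chain n) (a b : nat) :
  reflect [/\ bit a (chain_start C).-1, bit b (chain_start C).-1,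
              forall k, chain_start C <= k < chain_end C -> bit a k != bit b k
            & bit a (chain_end C) = bit b (chain_end C)]
          (generates C a b).
Proof.
have CP := chainP C.
apply: (iffP and4P) => -[ha hb hk hj]; split=> //; try exact/eqP.
  move=> k kP; have kn : k < n by lia.
  by have /forallP/(_ (Ordinal kn)) := hk; rewrite kP.
by apply/forallP => k; apply/implyP; apply: hk.
Qed.

(** The two ones just below the start generate a carry, and each unequal pair of digits propagates
    it. The end is included because the carry into it depends only on the digits one position
    lower. *)
Lemma carry_covered n (C : chain n) a b k :
  generates C a b -> covers C k -> carry a b k.
Proof.
have CP := chainP C; move=> /generatesP[ha hb hk _] /andP[].
elim: k => [|k IH] ik kj; first by lia.
have [ik'|ik'] := ltnP k (chain_start C).
  have kE : k = (chain_start C).-1 by lia.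
  by rewrite /= kE ha hb.
have kj' : k <= chain_end C by lia.
have kP : chain_start C <= k < chain_end C by lia.
by move: (hk k kP); rewrite /= (IH ik' kj'); case: (bit a k); case: (bit b k).
Qed.

(** Among covered positions, cutting can change digits only at the chain end; there the two digits
    were equal and become zero, so their sum modulo 2 stays 0. Both true carries are 1, and the
    pseudo-carries agree because both pairs generate [C]. *)
Lemma error_at_cut n (c : pseudo_adder n) (C : chain n) (a b : 'I_(2 ^ n))
    (k : 'I_n.+1) :
  chain_determined c -> generates C a b -> covers C k ->
  error_at c (cut C a) (cut C b) k = error_at c a b k.
Proof.
move=> det g kC; have gc := generates_cut g; have CP := chainP C.
have eqx : bit (cut_val C a) k (+) bit (cut_val C b) k = bit a k (+) bit b k.
  rewrite !bit_cut; have /andP[ik kj] := kC.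
  case: (ltnP k (chain_end C)) => kj'; first by rewrite (leq_trans (leq_pred _) ik).
  have -> : (k : nat) = chain_end C by lia.
  by case/generatesP: g => _ _ _ ->; rewrite andbF /= addbb.
have eqc : carry (cut_val C a) (cut_val C b) k = carry a b k.
  by apply/idP/idP => _; [exact: carry_covered g kC | exact: carry_covered gc kC].
have eqp : c k (cut C a) (cut C b) = c k a b by exact: (@det C (cut C a) (cut C b) a b gc g k kC).
by congr (Posz (nat_of_bool (_ (+) _) * _) - Posz (nat_of_bool (_ (+) _) * _))%R.
Qed.

Lemma chain_error_sum n (c : pseudo_adder n) (C : chain n) (a b : 'I_(2 ^ n)) :
  conservative c -> chain_determined c -> generates C a b ->
  chain_error c C = (\sum_(k < n.+1 | covers C k) error_at c a b k)%R.
Proof.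
move=> cons det g; rewrite (chain_errorE cons det g) error_sum.
rewrite (bigID (fun k : 'I_n.+1 => covers C k)) /= [X in (_ + X)%R]big1.
  by rewrite addr0; apply: eq_bigr => k kC; apply: error_at_cut.
(* Outside the covered positions the cut pair has no true carry. *)
by move=> k kC; apply: error_at_nocarry => //=; rewrite (carry_cut g).
Qed.

Lemma edge_trans n : transitive (@edge n).
Proof.
move=> D C E; have := chainP D; rewrite /edge; lia.
Qed.

(** Edges separate the closed intervals of any two chains of the path, so at most one term
    survives. *)
Lemma sum_covering_chains n (P : seq (chain n)) k (x : int) :
  sorted (@edge n) P ->
  (\sum_(C <- P | covers C k) x = if has (covers^~ k) P then x else 0)%R.
Proof.
elim: P => [|C P IH]; first by rewrite big_nil.
move=> sP; rewrite big_cons (IH (path_sorted sP)) /=.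
case: ifP => //= kC; case: ifP; last by rewrite addr0.
move=> /hasP[D DP kD]; move: sP; rewrite /= path_sortedE; last exact: edge_trans.
by case/andP=> /allP/(_ D DP); move: kC kD; rewrite /covers /edge; lia.
Qed.

(** Double counting over chains and positions: a covered position is counted exactly once, and an
    uncovered one has no true carry, hence no error. *)
Lemma error_path_weight n (c : pseudo_adder n) (a b : 'I_(2 ^ n)) (P : seq (chain n)) :
  conservative c -> chain_determined c -> sorted (@edge n) P ->
  {in P, forall C, generates C a b} ->
  (forall k, k <= n -> carry a b k -> has (covers^~ k) P) ->
  error c a b = path_weight c P.
Proof.
move=> cons det sP gP cov; rewrite /path_weight error_sum.
rewrite [RHS](eq_big_seq (fun C => \sum_(k < n.+1 | covers C k) error_at c a b k)%R);
  last by move=> C CP; apply: chain_error_sum => //; apply: gP.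
rewrite (exchange_big_dep predT) //=; apply: eq_bigr => k _.
rewrite sum_covering_chains //; case: ifPn => // nk.
apply: error_at_nocarry => //; apply: contra nk => ck.
by apply: cov => //; rewrite -ltnS.
Qed.

(** * The chains generated by a given pair *)

Lemma exists_chain n (i j : nat) :
  0 < i <= j -> j <= n -> exists2 C : chain n, chain_start C = i & chain_end C = j.
Proof.
move=> ij jn; have hi : i < n.+1 by lia.
pose p : 'I_n.+1 * 'I_n.+1 := (Ordinal hi, Ordinal (jn : j < n.+1)).
by exists (exist (fun p : 'I_n.+1 * 'I_n.+1 => 0 < p.1 <= p.2) p ij).
Qed.

Lemma bit_high n (a : 'I_(2 ^ n)) : bit a n = false.
Proof. by rewrite /bit divn_small. Qed.

(** Trace the carry downwards: either it is generated one position below, or it is propagated there,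
    which forces the two digits to differ. *)
Lemma carry_start a b k : carry a b k ->
  exists i, [/\ 0 < i <= k, bit a i.-1, bit b i.-1
              & forall m, i <= m < k -> bit a m != bit b m].
Proof.
elim: k => // k IH /= h.
have [ab|nab] := boolP (bit a k && bit b k).
  by case/andP: ab => ha hb; exists k.+1; rewrite leqnn; split=> // m; lia.
have [ck nk] : carry a b k /\ bit a k != bit b k.
  by move: h nab; case: (bit a k); case: (bit b k); case: carry.
have [i [ik ha hb hm]] := IH ck; exists i; split=> // [|m]; first by lia.
by have [-> //|mk] := eqVneq m k => mP; apply: hm; lia.
Qed.

Lemma carry_chain n (a b : 'I_(2 ^ n)) k : k <= n -> carry a b k ->
  exists2 C : chain n, generates C a b & covers C k.
Proof.
move=> kn /carry_start[i [ik ha hb hm]].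
(* The chain ends at the first position from [k] on with equal digits; position [n], where both
   digits are 0, guarantees one. *)
have ex : exists j, (k <= j) && (bit a j == bit b j).
  by exists n; rewrite kn !bit_high.
case: (ex_minnP ex) => j /andP[kj /eqP jE] jmin.
have jn : j <= n by apply: jmin; rewrite kn !bit_high.
have ij : 0 < i <= j by lia.
have [C Ci Cj] := exists_chain ij jn; exists C; last by rewrite /covers; lia.
apply/generatesP; rewrite Ci Cj; split=> // m mP.
have [mk|km] := ltnP m k; first by apply: hm; lia.
by apply/negP => mE; have := jmin m; rewrite km mE => /(_ isT); lia.
Qed.

Lemma chain_inj n (C D : chain n) :
  chain_start C = chain_start D -> chain_end C = chain_end D -> C = D.
Proof.
case: C D => [[i j] hC] [[i' j'] hD]; rewrite /chain_start /chain_end /=.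
move=> /val_inj e1 /val_inj e2.
by apply: val_inj; rewrite /= e1 e2.
Qed.

(** If the intervals met, a position with equal digits would fall among propagating ones: the
    generating position of [D] inside [C] when the starts differ, the smaller of the two ends when
    they coincide. *)
Lemma generates_edge n (C D : chain n) (a b : nat) :
  generates C a b -> generates D a b -> chain_start C <= chain_start D ->
  C != D -> edge C D.
Proof.
have CP := chainP C; have DP := chainP D.
move=> /generatesP[_ _ hC jC] /generatesP[ha hb hD jD] le ne.
rewrite /edge ltnNge; apply/negP => le'.
have [e|ne'] := eqVneq (chain_start C) (chain_start D); last first.
  have kP : chain_start C <= (chain_start D).-1 < chain_end C by lia.
  by have := hC _ kP; rewrite ha hb.
have [l|l|e'] := ltngtP (chain_end C) (chain_end D).
- have kP : chain_start D <= chain_end C < chain_end D by lia.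
  by have := hD _ kP; rewrite jC eqxx.
- have kP : chain_start C <= chain_end D < chain_end C by lia.
  by have := hC _ kP; rewrite jD eqxx.
- by move/eqP: ne; apply; apply: chain_inj.
Qed.

(** Sorting by start gives only a weak order; since the list has no repetitions, [generates_edge]
    turns it into edges. *)
Lemma generated_path n (a b : nat) :
  exists2 P : seq (chain n), sorted (@edge n) P & P =i [pred C | generates C a b].
Proof.
pose le (C D : chain n) := chain_start C <= chain_start D.
pose s := [seq C <- enum {: chain n} | generates C a b].
exists (sort le s); last first.
  by move=> C; rewrite mem_sort mem_filter mem_enum andbT.
have gs : {in sort le s, forall C, generates C a b}.
  by move=> C; rewrite mem_sort mem_filter => /andP[].
have us : uniq (sort le s) by rewrite sort_uniq filter_uniq // enum_uniq.
have tl : transitive le by move=> D C E; apply: leq_trans.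
have ss : sorted le (sort le s) by apply: sort_sorted => C D; apply: leq_total.
elim: (sort le s) gs us ss => //= C t IH gs /andP[Ct ut].
rewrite (path_sortedE tl) (path_sortedE (@edge_trans n)) => /andP[/allP leC st].
apply/andP; split; last by apply: IH => // D Dt; apply: gs; rewrite inE Dt orbT.
apply/allP => D Dt; apply: (@generates_edge _ _ _ a b).
- by apply: gs; rewrite mem_head.
- by apply: gs; rewrite inE Dt orbT.
- exact: leC.
- by apply: contraNneq Ct => ->.
Qed.

(** * A pair generating the chains of a given path *)

Lemma sorted_edge_total n (P : seq (chain n)) :
  sorted (@edge n) P ->
  {in P &, forall C D, [|| C == D, edge C D | edge D C]}.
Proof.
rewrite (sorted_pairwise (@edge_trans n)) => /(pairwiseP) h C D CP DP.
have [ij|ij|ij] := ltngtP (index C P) (index D P).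
- have := h C (index C P) (index D P); rewrite !inE !index_mem !nth_index //.
  by move=> -> //; rewrite orbT.
- have := h C (index D P) (index C P); rewrite !inE !index_mem !nth_index //.
  by move=> -> //; rewrite !orbT.
- by rewrite -(nth_index C CP) ij nth_index // eqxx.
Qed.

Lemma path_generated n (P : seq (chain n)) :
  sorted (@edge n) P ->
  exists a b : 'I_(2 ^ n),
    {in P, forall C, generates C a b} /\
    (forall k, carry a b k -> has (covers^~ k) P).
Proof.
move=> sP; have tot := sorted_edge_total sP.
(* The first number has ones along the whole digit range of every chain, the second only at the
   generating positions. *)
pose fa k := has (fun C : chain n => (chain_start C).-1 <= k < chain_end C) P.
pose fb k := has (fun C : chain n => (chain_start C).-1 == k) P.
have fba k : fb k -> fa k.
  move=> /hasP[C CP /eqP kE]; apply/hasP; exists C => //.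
  by have := chainP C; lia.
have fan k : fa k -> k < n.
  by move=> /hasP[C CP ?]; have := chainP C; lia.
exists (Ordinal (sum_bits_lt fa n)), (Ordinal (sum_bits_lt fb n)).
have ba k : bit (\sum_(0 <= k < n) fa k * 2 ^ k) k = fa k.
  by rewrite bit_sum_bits; case E: (fa k); rewrite ?andbF // fan.
have bb k : bit (\sum_(0 <= k < n) fb k * 2 ^ k) k = fb k.
  by rewrite bit_sum_bits; case E: (fb k); rewrite ?andbF // fan // fba.
split=> [C CP|k] /=; last first.
  (* A carry into [k.+1] needs a one at [k], which by [fba] lies in the digit range of some chain;
     shifting by one gives a covered position. *)
  case: k => //= k; rewrite ba bb => h.
  have /hasP[C CP kC] : fa k.
    by move: h (fba k); case: (fa k) (fb k) => [] [] //= _ /(_ isT).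
  by apply/hasP; exists C => //; rewrite /covers; lia.
have Cb := chainP C.
have fbC : fb (chain_start C).-1 by apply/hasP; exists C.
apply/generatesP; rewrite !ba !bb fbC fba //; split=> // [k kC|].
  rewrite ba bb; have -> : fa k by apply/hasP; exists C => //; lia.
  (* A chain generating at [k] would overlap [C]. *)
  have -> // : fb k = false.
  apply/negP => /hasP[D DP /eqP kD].
  have Db := chainP D; have := tot C D CP DP; rewrite /edge.
  by case/or3P => [/eqP E| |]; [move: kD; rewrite -E | |]; lia.
(* The end of [C] may be the generating position of the next chain; then both digits are 1,
   otherwise both are 0. *)
apply/idP/idP; last exact: fba.
move=> /hasP[D DP kD]; apply/hasP; exists D => //.
have Db := chainP D; have := tot C D CP DP; rewrite /edge.
by case/or3P => [/eqP E| |]; [move: kD; rewrite -E | |]; lia.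
Qed.

(** * Path weights as errors, and the extremal values *)

Lemma path_weight_error n (c : pseudo_adder n) (P : seq (chain n)) :
  conservative c -> chain_determined c -> is_path P ->
  exists a b : 'I_(2 ^ n),
    (exists C : chain n, generates C a b) /\ path_weight c P = error c a b.
Proof.
move=> cons det /andP[P0 sP]; have [a [b [gP cov]]] := path_generated sP.
exists a, b; split.
  by case: P P0 gP {sP cov} => // C P _ gP; exists C; apply: gP; rewrite mem_head.
by rewrite (error_path_weight cons det sP gP) // => k _; apply: cov.
Qed.

Lemma error_is_path_weight n (c : pseudo_adder n) (a b : 'I_(2 ^ n)) :
  conservative c -> chain_determined c ->
  (exists C : chain n, generates C a b) ->
  exists2 P : seq (chain n), is_path P & path_weight c P = error c a b.
Proof.
move=> cons det [C gC]; have [P sP PE] := generated_path n a b.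
exists P.
  rewrite /is_path sP andbT; have : C \in P by rewrite PE.
  by case: P {sP PE}.
symmetry; apply: error_path_weight => // [D|k kn ck]; first by rewrite PE.
have [D gD kD] := carry_chain kn ck.
by apply/hasP; exists D => //; rewrite PE.
Qed.

Lemma error_no_chain n (c : pseudo_adder n) (a b : 'I_(2 ^ n)) :
  conservative c -> ~ (exists C : chain n, generates C a b) -> error c a b = 0%R.
Proof.
move=> cons nC; rewrite error_sum big1 // => k _; apply: error_at_nocarry => //.
apply/negP => ck; have [|C gC _] := carry_chain _ ck; first by rewrite -ltnS.
by apply: nC; exists C.
Qed.

Lemma abs_error_le n (c : pseudo_adder n) a b :
  (`|error c a b|%N <= max_abs_error c)%N.
Proof.
by apply: leq_trans (leq_bigmax a); apply: (leq_bigmax (F := fun b => `|error c a b|%N)).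
Qed.

Theorem theorem4 (n : nat) (hn : (1 <= n)%N) (c : pseudo_adder n)
    (hcons : conservative c) (hdet : chain_determined c) :
  exists wmin wmax : int,
    [/\ is_min_path_weight c wmin,
        is_max_path_weight c wmax
      & Posz (max_abs_error c) = Num.max (- wmin)%R wmax].
Proof.
(* Paths are nonempty, so the extrema are taken only over pairs generating some chain; a pair for
   the 1-1 chain shows that such pairs exist. *)
pose Q (x : 'I_(2 ^ n) * 'I_(2 ^ n)) := [exists C : chain n, generates C x.1 x.2].
have [C1 _ _] := @exists_chain n 1 1 isT hn.
have [x0 gx0] := generates_ex C1.
have Qx0 : Q x0 by apply/existsP; exists C1.
pose err (x : 'I_(2 ^ n) * 'I_(2 ^ n)) : int := error c x.1 x.2.
case: (arg_minP err Qx0) => x Qx xmin; case: (arg_maxP err Qx0) => y Qy ymax.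
have path_of z : Q z -> exists2 P, is_path P & path_weight c P = err z.
  by move=> /existsP Qz; apply: error_is_path_weight.
have of_path P : is_path P -> exists2 z, Q z & path_weight c P = err z.
  move=> /(path_weight_error hcons hdet)[a [b [/existsP Qab wE]]].
  by exists (a, b).
exists (err x), (err y); split.
- by split=> [|P /of_path[z Qz ->]]; [exact: path_of | exact: xmin].
- by split=> [|P /of_path[z Qz ->]]; [exact: path_of | exact: ymax].
have xy : (err x <= err y)%R := xmin _ Qy.
have := abs_error_le c x.1 x.2; have := abs_error_le c y.1 y.2.
rewrite -/(err x) -/(err y) => ley lex.
(* The absolute value is harmless: [xy] makes the maximum nonnegative. *)
suff : max_abs_error c <= `|Num.max (- err x)%R (err y)|%N by lia.
apply/bigmax_leqP => a _; apply/bigmax_leqP => b _.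
have [Qz|nQ] := boolP (Q (a, b)).
  by rewrite -[error c a b]/(err (a, b)); have := xmin _ Qz; have := ymax _ Qz; lia.
by rewrite error_no_chain // => /existsP; rewrite -/(Q (a, b)); apply/negP.
Qed.
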